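(* Let $\mathcal H$ be a complex Hilbert space of finite dimension $d\ge 2$ and let $P$ be a rank-one orthogonal projection on $\mathcal H$. The action of $G_P$ on $\mathfrak M_{1,P}:=\mathfrak M_1(\mathcal H)\cap\mathfrak M_P$ is transitive.
   Context: A projective measurement on $\mathcal H$ is an unordered finite family (set) $\mathsf M=\{P_1,\dots,P_m\}$ of nonzero pairwise orthogonal orthogonal projections on $\mathcal H$ with $\sum_{j=1}^m P_j=I$. It is maximal if every $P_j$ has rank one. $\mathfrak M(\mathcal H)$ is the set of all projective measurements, $\mathfrak M_1(\mathcal H)$ the set of maximal ones, and $\mathfrak M_P=\{\mathsf M\in\mathfrak M(\mathcal H):P\in\mathsf M\}$. The group $G_P=\{U\in\mathcal U(\mathcal H):Ux=x\text{ for every }x\in\operatorname{ran}P\}$, where $\mathcal U(\mathcal H)$ is the unitary group, acts by $U\cdot\mathsf M=U\mathsf MU^*:=\{UQU^*:Q\in\mathsf M\}$. *)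

(* Defs.v *)
From HB Require Import structures.
From mathcomp Require Import all_boot all_order all_algebra.
From mathcomp Require Import sesquilinear complex.
From mathcomp Require Import finmap boolp classical_sets reals.

Set Implicit Arguments.
Unset Strict Implicit.
Unset Printing Implicit Defensive.
Import Order.TTheory GRing.Theory Num.Theory.
Local Open Scope ring_scope.
Local Open Scope classical_set_scope.

Section GroupAction.
Variables (G : groupType) (T : Type) (K : set G) (act : G -> T -> T).
Variable X : set T.
Local Open Scope group_scope.

Definition subgroup : Prop :=
  [/\ K 1, forall g h, K g -> K h -> K (g * h) & forall g, K g -> K g^-1].

Definition group_action : Prop :=
  [/\ subgroup,
      forall g x, K g -> X x -> X (act g x),
      forall x, X x -> act 1 x = x &
      forall g h x, K g -> K h -> X x -> act (g * h) x = act g (act h x)].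

(* A single orbit; as for the finite [transitive A, on S | to], the empty set
   is excluded. *)
Definition transitive_action : Prop :=
  X !=set0 /\ forall x y, X x -> X y -> exists2 g, K g & act g x = y.

End GroupAction.

(* A finite-dimensional complex Hilbert space is a [vectType] over [R[i]] with
   a positive definite Hermitian form [dot], linear in its first argument
   (completeness is automatic in finite dimension). *)
Section Adjoint.
Variables (R : realType) (H : vectType R[i]) (dot : {dot H for Num.conj}).
Implicit Types A B : 'End(H).

Definition is_adjoint A B : Prop := forall x y, dot (A x) y = dot x (B y).

(* The default value 0 is never used, see [adjointP]. *)
Definition adjoint A : 'End(H) := xget 0 [set B | is_adjoint A B].

Lemma dot_inj x y : (forall z, dot z x = dot z y) -> x = y.
Proof.
move=> e; apply/eqP; rewrite -subr_eq0; apply/negP => /negP.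
move=> /(@neq0_dnorm_gt0 _ _ _ dot).
have -> : dot (x - y) (x - y) = dot (x - y) x - dot (x - y) y.
  exact: linearBr.
by rewrite e subrr ltxx.
Qed.

Lemma is_adjoint_unique A B B' : is_adjoint A B -> is_adjoint A B' -> B = B'.
Proof.
by move=> hB hB'; apply/lfunP => y; apply: dot_inj => x; rewrite -hB hB'.
Qed.

Lemma dotC x y : dot x y = Num.conj (dot y x).
Proof. by rewrite (hermC dot) expr0 mul1r. Qed.

Lemma adjointP A : is_adjoint A (adjoint A).
Proof.
rewrite /adjoint; apply: (@xgetPex _ 0 [set B | is_adjoint A B]).
pose n := \dim {:H}; pose b := vbasis {:H}.
pose coords (A' : 'End(H)) z : 'rV[R[i]]_n := \row_j dot z (A' b`_j).
have cl A' : linear (coords A').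
  by move=> a u v; apply/rowP => j; rewrite !mxE linearPl.
pose cL A' : {linear H -> 'rV[R[i]]_n} :=
  HB.pack (coords A') (GRing.isLinear.Build _ _ _ _ (coords A') (cl A')).
pose f A' : 'Hom(H, 'rV[R[i]]_n) := linfun (cL A').
have fE A' z j : f A' z 0 j = dot z (A' b`_j) by rewrite lfunE /= mxE.
have ext A1 A2 u v : (forall j : 'I_n, dot u (A1 b`_j) = dot v (A2 b`_j)) ->
    forall x, dot u (A1 x) = dot v (A2 x).
  move=> e x; rewrite (coord_vbasis (memvf x)).
  pose g A' w z := dot w (A' z).
  have gD A' w : {morph g A' w : p q / p + q}.
    by move=> p q; rewrite /g raddfD; exact: linearDr.
  have g0 A' w : g A' w 0 = 0 by rewrite /g raddf0; exact: linear0r.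
  have gZ A' w a z : g A' w (a *: z) = Num.conj a * g A' w z.
    by rewrite /g linearZ; exact: linearZr.
  rewrite -![dot _ (_ (\sum_(_ < _) _))]/(g _ _ _).
  rewrite !(big_morph _ (gD _ _) (g0 _ _)).
  by apply: eq_bigr => j _; rewrite !gZ /g e.
have kf : lker (f \1%VF) == 0%VS.
  apply/lker0P => u v /rowP e; apply: dot_inj => x; rewrite dotC [RHS]dotC.
  congr (Num.conj _); have := ext \1%VF \1%VF u v _ x; rewrite !lfunE; apply.
  by move=> j; have := e j; rewrite !fE.
have lf : limg (f \1%VF) = fullv.
  apply/eqP; rewrite eqEdim subvf limg_dim_eq; last by rewrite (eqP kf) capv0.
  by rewrite [X in (X <= _)%N]dimvf /dim /= mul1n.
exists ((f \1%VF)^-1 \o f A)%VF.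
move=> x y; rewrite dotC [RHS]dotC; congr (Num.conj _).
have := ext A \1%VF y (((f \1%VF)^-1 \o f A)%VF y) _ x.
rewrite [\1%VF x]id_lfunE; apply=> j.
by rewrite -!fE comp_lfunE limg_lfunVK // lf memvf.
Qed.

Lemma adjointE A B : is_adjoint A B -> adjoint A = B.
Proof. exact/is_adjoint_unique/adjointP. Qed.

Lemma adjointK A : adjoint (adjoint A) = A.
Proof. by apply: adjointE => x y; rewrite dotC -adjointP -dotC. Qed.

Lemma adjoint1 : adjoint \1%VF = \1%VF.
Proof. by apply: adjointE => x y; rewrite !id_lfunE. Qed.

Lemma adjointM A B : adjoint (A \o B)%VF = (adjoint B \o adjoint A)%VF.
Proof. by apply: adjointE => x y; rewrite !comp_lfunE -!adjointP. Qed.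

Definition unitary_op : pred 'End(H) :=
  fun U => (adjoint U \o U == \1)%VF && (U \o adjoint U == \1)%VF.

Record unitary := Unitary {unitary_val :> 'End(H); _ : unitary_op unitary_val}.
HB.instance Definition _ := [isSub for unitary_val].
HB.instance Definition _ := [Choice of unitary by <:].

Lemma unitary_op1 : unitary_op \1%VF.
Proof. by rewrite /unitary_op adjoint1 comp_lfun1l eqxx. Qed.

Lemma unitary_opV (U : unitary) : unitary_op (adjoint U).
Proof. by case: U => U /= /andP[h1 h2]; rewrite /unitary_op adjointK h1 h2. Qed.

Lemma unitary_opM (U V : unitary) : unitary_op (U \o V)%VF.
Proof.
case: U V => [U /andP[/eqP U1 /eqP U2]] [V /andP[/eqP V1 /eqP V2]] /=.
rewrite /unitary_op adjointM; apply/andP; split; apply/eqP.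
  by rewrite -comp_lfunA (comp_lfunA _ U) U1 comp_lfun1l.
by rewrite -comp_lfunA (comp_lfunA V) V2 comp_lfun1l.
Qed.

Definition unitary_one : unitary := Unitary unitary_op1.
Definition unitary_inv (U : unitary) : unitary := Unitary (unitary_opV U).
Definition unitary_mul (U V : unitary) : unitary := Unitary (unitary_opM U V).

Lemma unitary_mulA : associative unitary_mul.
Proof. by move=> U V W; apply: val_inj; rewrite /= comp_lfunA. Qed.
Lemma unitary_mul1g : left_id unitary_one unitary_mul.
Proof. by move=> U; apply: val_inj; rewrite /= comp_lfun1l. Qed.
Lemma unitary_mulg1 : right_id unitary_one unitary_mul.
Proof. by move=> U; apply: val_inj; rewrite /= comp_lfun1r. Qed.
Lemma unitary_mulVg : left_inverse unitary_one unitary_inv unitary_mul.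
Proof. by move=> [U h]; apply: val_inj => /=; case/andP: (h) => /eqP. Qed.
Lemma unitary_mulgV : right_inverse unitary_one unitary_inv unitary_mul.
Proof. by move=> [U h]; apply: val_inj => /=; case/andP: (h) => _ /eqP. Qed.

HB.instance Definition _ := isGroup.Build unitary unitary_mulA
  unitary_mul1g unitary_mulg1 unitary_mulVg unitary_mulgV.

End Adjoint.

Section Measurements.
Variables (R : realType) (H : vectType R[i]) (dot : {dot H for Num.conj}).
Implicit Types (P Q : 'End(H)) (M : {fset 'End(H)}) (U : unitary dot).

Definition orthogonal_projection P : Prop :=
  (P \o P)%VF = P /\ adjoint dot P = P.

Definition rank_one P : Prop := \dim (limg P) = 1%N.

Definition projective_measurements : set {fset 'End(H)} :=
  [set M : {fset 'End(H)} |
           [/\ forall P, P \in M -> orthogonal_projection P /\ P != 0,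
               forall P Q, P \in M -> Q \in M -> P != Q -> (P \o Q)%VF = 0 &
               \sum_(P <- M) P = \1%VF]].

Definition maximal_measurements : set {fset 'End(H)} :=
  [set M : {fset 'End(H)} |
    projective_measurements M /\ forall P, P \in M -> rank_one P].

Definition measurements_with P : set {fset 'End(H)} :=
  [set M : {fset 'End(H)} | projective_measurements M /\ P \in M].

Definition range_fixing_unitaries P : set (unitary dot) :=
  [set U : unitary dot | forall x, x \in limg P -> U x = x].

Definition conj_measurement U M : {fset 'End(H)} :=
  [fset (U \o Q \o adjoint dot U)%VF | Q in M]%fset.

End Measurements.

Arguments range_fixing_unitaries {R H} dot P.
Arguments conj_measurement {R H} dot U M.

(* Main.v *)
(* Writing [ketbra p] for the projection onto the line of a unit vector [p], the
   maximal measurements containing [ketbra p] are exactly the families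
   [ketbra x], x in s, for the orthonormal bases s with first vector p, and
   [U (ketbra x) U^* = ketbra (U x)].  Since [U] fixes the range of [ketbra p]
   iff [U p = p], everything reduces to orthonormal bases: the unitary mapping
   one basis to another fixes the common first vector [p]. *)
Require Import Defs.
From HB Require Import structures.
From mathcomp Require Import all_boot all_order all_algebra.
From mathcomp Require Import sesquilinear complex.
From mathcomp Require Import finmap boolp classical_sets reals.

Import Order.TTheory GRing.Theory Num.Theory.
Local Open Scope ring_scope.
Local Open Scope classical_set_scope.

Section OrthonormalBases.
Set Implicit Arguments.
Unset Strict Implicit.
Variables (R : realType) (H : vectType R[i]) (dot : {dot H for Num.conj}).
Implicit Types (x y z : H) (s t : seq H) (U : unitary dot).

(** * Rank-one projections and unit vectors *)

Definition ketbra_fun x z : H := dot z x *: x.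

Lemma ketbra_fun_linear x : linear (ketbra_fun x).
Proof. by move=> a u v; rewrite /ketbra_fun linearPl scalerDl scalerA. Qed.

HB.instance Definition _ x :=
  GRing.isLinear.Build _ _ _ _ (ketbra_fun x) (ketbra_fun_linear x).

Definition ketbra x : 'End(H) := linfun (ketbra_fun x).

Lemma ketbraE x z : ketbra x z = dot z x *: x.
Proof. by rewrite lfunE. Qed.

Lemma ketbra_adjoint x : adjoint dot (ketbra x) = ketbra x.
Proof.
apply: adjointE => y z; rewrite !ketbraE linearZl_LR linearZr_LR /=.
by rewrite -dotC mulrC.
Qed.

Lemma ketbra_comp x y : dot y x = 0 -> (ketbra x \o ketbra y)%VF = 0.
Proof.
move=> yx0; apply/lfunP => z; rewrite comp_lfunE !ketbraE linearZl_LR /= yx0.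
by rewrite mulr0 scale0r lfunE.
Qed.

Lemma ketbra_idem x : dot x x = 1 -> (ketbra x \o ketbra x)%VF = ketbra x.
Proof.
move=> xx; apply/lfunP => z; rewrite comp_lfunE !ketbraE linearZl_LR /= xx.
by rewrite mulr1.
Qed.

Lemma unit_neq0 x : dot x x = 1 -> x != 0.
Proof. by move=> xx; rewrite -(dnorm_eq0 dot) xx oner_eq0. Qed.

Lemma limg_ketbra x : dot x x = 1 -> limg (ketbra x) = <[x]>%VS.
Proof.
move=> xx; apply/eqP; rewrite eqEsubv; apply/andP; split.
  apply/subvP => _ /memv_imgP[z _ ->]; rewrite ketbraE.
  by rewrite memvZ ?memv_line.
rewrite -memvE; apply/memv_imgP; exists x; first exact: memvf.
by rewrite ketbraE xx scale1r.
Qed.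

Lemma exists_normalization x :
  x != 0 -> exists2 a, a != 0 & dot (a *: x) (a *: x) = 1.
Proof.
move=> x0; exists (sqrtC (dot x x))^-1.
  by rewrite invr_eq0 sqrt_dnorm_eq0.
rewrite dnormZ normfV exprVn ger0_norm ?sqrt_dnorm_ge0 // sqrtCK mulVf //.
by rewrite dnorm_eq0.
Qed.

(** A unit vector [x] spanning the range is fixed by [Q]. Writing [Q z = b *: x], self-adjointness
    gives [b = dot (Q z) x = dot z (Q x) = dot z x]. *)
Lemma rank_one_projectionP Q : orthogonal_projection dot Q -> rank_one Q ->
  exists2 x, dot x x = 1 & Q = ketbra x.
Proof.
case=> QQ Qadj rQ; have Q0 : limg Q != 0%VS by rewrite -dimv_eq0 rQ.
have v0 : vpick (limg Q) != 0 by rewrite vpick0.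
have [a a0 aa] := exists_normalization v0.
exists (a *: vpick (limg Q)) => //; set x := a *: _ in aa *.
have xQ : x \in limg Q by rewrite memvZ // memv_pick.
have Qx : Q x = x.
  by have /memv_imgP[y _ ->] := xQ; rewrite -comp_lfunE QQ.
have QE : limg Q = <[x]>%VS.
  apply/esym/eqP; rewrite eqEdim -memvE xQ dim_vline unit_neq0 //.
  by rewrite [X in (X <= _)%N]rQ.
apply/lfunP => z; rewrite ketbraE.
have := memv_img Q (memvf z); rewrite QE => /vlineP[b Qz].
rewrite Qz; congr (_ *: _); rewrite -[in RHS]Qx -Qadj -adjointP Qz.
by rewrite linearZl_LR /= aa mulr1.
Qed.

(** * Orthonormal bases, completeness and extension *)

Definition orthonormal_basis s : Prop :=
  orthonormal dot s /\ size s = \dim {:H}.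

Lemma span_orthonormal_basis s : orthonormal_basis s -> <<s>>%VS = fullv.
Proof.
case=> /orthonormal_free fs sz; apply/eqP.
by rewrite eqEdim subvf (eqnP fs) sz /=.
Qed.

(** Both sides agree on the spanning list [s]: at [y] in [s] only the summand [ketbra y]
    survives. *)
Lemma sum_ketbra s : orthonormal_basis s -> \sum_(x <- s) ketbra x = \1%VF.
Proof.
move=> ons; have /orthonormalP[us os] := ons.1.
apply/(fullv_lfunP _ _ (span_orthonormal_basis ons)) => y ys.
rewrite sum_lfunE id_lfunE (bigD1_seq y) //= ketbraE os // eqxx scale1r.
rewrite big_seq_cond big1 ?addr0 // => x /andP[xs xy].
by rewrite ketbraE os // eq_sym (negbTE xy) scale0r.
Qed.

(** Applying the sum to any [z] writes it as a combination of [s], so the free list [s] spans and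
    its size is the dimension. *)
Lemma orthonormal_basis_sum s : orthonormal dot s ->
  \sum_(x <- s) ketbra x = \1%VF -> orthonormal_basis s.
Proof.
move=> os sum1; split=> //; have /eqnP <- := orthonormal_free os.
congr (\dim _); apply/eqP; rewrite eqEsubv subvf /=; apply/subvP => z _.
rewrite -[z]id_lfunE -sum1 sum_lfunE big_seq memv_suml // => x xs.
by rewrite ketbraE memvZ // memv_span.
Qed.

(** Gram-Schmidt, by induction on the number [n] of missing vectors: a vector outside the span is
    replaced by its normalized component orthogonal to [s]. *)
Lemma orthonormal_extend s : orthonormal dot s -> (size s <= \dim {:H})%N ->
  exists t, orthonormal_basis (s ++ t).
Proof.
move=> os /subnKC; move: (_ - _)%N => n; elim: n s os => [|n IHn] s os sz.
  by exists [::]; rewrite cats0; split=> //; rewrite -sz addn0.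
have [z zs] : exists z, z \notin <<s>>%VS.
  (* If [s] spanned the whole space, the dimension would be at most [size s], whereas it is
     [size s + n.+1]. *)
  apply: contrapT => /forallNP sf; have := dim_span s.
  have -> : <<s>>%VS = fullv.
    apply/eqP; rewrite eqEsubv subvf /=; apply/subvP => z _.
    by apply/negPn/negP/sf.
  by rewrite -sz addnS ltnNge leq_addr.
have [x xs [y [zE _ yos]]] := orthogonal_split dot s z.
have y0 : y != 0.
  by apply: contraNneq zs => y0; rewrite zE y0 addr0.
have [a a0 aa] := exists_normalization y0.
have [||t ont] := IHn (rcons s (a *: y)).
- rewrite -cats1 orthonormal_cat os /orthonormal /= aa eqxx /=.
  rewrite orthogonal_sym; apply/orthoPl => u us.
  by rewrite linearZl_LR /= (orthoPl yos _ us) mulr0.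
- by rewrite size_rcons addSnnS.
by exists (a *: y :: t); rewrite -cat_rcons.
Qed.

(** * Unitaries acting on orthonormal bases *)

Lemma unitary_dot U x y : dot (U x) (U y) = dot x y.
Proof.
have /andP[/eqP UU _] := valP U.
by rewrite adjointP -comp_lfunE UU id_lfunE.
Qed.

Lemma unitary_orthonormal_basis U s :
  orthonormal_basis s -> orthonormal_basis (map U s).
Proof.
have Ui : injective U.
  move=> x y; have /andP[/eqP UU _] := valP U.
  by move/(congr1 (adjoint dot U)); rewrite -!comp_lfunE UU !id_lfunE.
case=> /orthonormalP[us os] sz; split; last by rewrite size_map.
apply/orthonormalP; split; first by rewrite map_inj_uniq.
move=> _ _ /mapP[x xs ->] /mapP[y ys ->].
by rewrite unitary_dot os // (inj_eq Ui).
Qed.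

(** Matching orthogonal lists with equal norms yields a linear isometry [tau] on the span of [s],
    which is everything. Isometry gives [U^* U = 1], hence injectivity; in finite dimension [U] is
    then invertible with inverse [U^*], so [U U^* = 1] too. *)
Lemma unitary_of_orthonormal_bases s t :
  orthonormal_basis s -> orthonormal_basis t -> exists U, map U s = t.
Proof.
move=> ons ont; have /orthonormalP[us os] := ons.1.
have /orthonormalP[ut ot] := ont.1.
have [|tau tauE isotau] := isometry_of_dnorm
  (orthonormal_orthogonal ons.1) (orthonormal_orthogonal ont.1).
  have n1 r : orthonormal dot r -> map (normf1 dot) r = nseq (size r) 1.
    case/andP=> /allP nr _; rewrite -(size_map (normf1 dot)).
    apply/all_pred1P/allP => _ /mapP[x xr ->] /=.
    exact: nr.
  by rewrite [LHS]n1 ?ont.1 // n1 ?ons.1 // ons.2 ont.2.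
move: isotau; rewrite (span_orthonormal_basis ons) => isotau.
have UU : (adjoint dot (linfun tau) \o linfun tau = \1)%VF.
  apply/lfunP => y; apply: (dot_inj (dot := dot)) => x.
  by rewrite comp_lfunE -adjointP !lfunE /= isotau ?memvf.
have kU : lker (linfun tau) == 0%VS.
  apply/lker0P => x y /(congr1 (adjoint dot (linfun tau))).
  by rewrite -!comp_lfunE UU !id_lfunE.
have Vadj : adjoint dot (linfun tau) = (linfun tau)^-1%VF.
  by rewrite -[LHS](lker0_compfK kU) UU comp_lfun1l.
have unU : unitary_op dot (linfun tau).
  by rewrite /unitary_op UU Vadj lker0_compfV // !eqxx.
exists (Unitary unU); rewrite -tauE; apply: eq_map => x /=.
by rewrite lfunE.
Qed.

(** * Maximal measurements and orthonormal bases *)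

Definition basis_measurement s : {fset 'End(H)} :=
  [fset ketbra x | x in s]%fset.

Lemma conj_ketbra U x :
  (U \o ketbra x \o adjoint dot U)%VF = ketbra (U x).
Proof.
apply/lfunP => z; rewrite !comp_lfunE !ketbraE linearZ /=.
by rewrite (adjointP dot (adjoint dot U)) adjointK.
Qed.

Lemma conj_basis_measurement U s :
  conj_measurement dot U (basis_measurement s) = basis_measurement (map U s).
Proof.
apply/fsetP => Q; apply/imfsetP/imfsetP => /=.
  move=> [_ /imfsetP[x /= xs ->] ->]; exists (U x); first exact: map_f.
  exact: conj_ketbra.
move=> [_ /mapP[x xs ->] ->]; exists (ketbra x); last by rewrite conj_ketbra.
by apply/imfsetP; exists x.
Qed.

(** Forming a finite set could merge entries; orthonormality makes [ketbra] injective on [s], so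
    sums over the set can be computed along the list. *)
Lemma perm_basis_measurement s : orthonormal dot s ->
  perm_eq (basis_measurement s) (map ketbra s).
Proof.
move=> /orthonormalP[us os]; apply: uniq_perm => [||Q].
- exact: fset_uniq.
(* Evaluating [ketbra x = ketbra y] at [x] gives [x = dot x y *: y]; for distinct [x] and [y] this
   forces [x = 0]. *)
- rewrite map_inj_in_uniq // => x y xs ys /lfunP/(_ x).
  rewrite !ketbraE !os // eqxx; case: eqVneq => // _.
  rewrite scale1r scale0r => x0; have := os x x xs xs.
  by rewrite x0 linear0r eqxx => /eqP; rewrite eq_sym oner_eq0.
by apply/imfsetP/mapP => -[x xs ->]; exists x.
Qed.

Lemma basis_measurement_maximal s : orthonormal_basis s ->
  maximal_measurements dot (basis_measurement s).
Proof.
move=> ons; have /orthonormalP[us os] := ons.1.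
have s1 x : x \in s -> dot x x = 1 by move=> xs; rewrite os ?eqxx.
have rk x : x \in s -> rank_one (ketbra x).
  by move=> xs; rewrite /rank_one limg_ketbra ?s1 // dim_vline unit_neq0 ?s1.
split; last by move=> _ /imfsetP[x xs ->]; exact: rk.
split.
- move=> _ /imfsetP[x xs ->]; split.
    by split; [apply/ketbra_idem/s1 | exact: ketbra_adjoint].
  by apply: contra_eq_neq (rk x xs) => ->; rewrite lim0g dimv0.
- move=> _ _ /imfsetP[x xs ->] /imfsetP[y ys ->] xy.
  apply: ketbra_comp; rewrite os //; have [yx|//] := eqVneq y x.
  by rewrite yx eqxx in xy.
by rewrite (perm_big _ (perm_basis_measurement ons.1)) big_map sum_ketbra.
Qed.

(** One unit vector is chosen in the range of each projection: products equal to 0 make these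
    vectors orthogonal, and the sum being the identity makes them complete. *)
Lemma maximal_measurement_basis p M : dot p p = 1 ->
  maximal_measurements dot M -> ketbra p \in M ->
  exists2 s, orthonormal_basis (p :: s) & M = basis_measurement (p :: s).
Proof.
move=> pp [[projM orthM sumM] rkM] pM.
(* The last clause makes the unit vector chosen for [ketbra p] equal to [p],
   not merely to a phase multiple of it. *)
have /choice[f fP] (Q : 'End(H)) : exists x, Q \in M ->
    [/\ dot x x = 1, Q = ketbra x & Q = ketbra p -> x = p].
  have [-> | Qp] := eqVneq Q (ketbra p); first by exists p.
  (* Outside [M] nothing is asked of the vector, so 0 serves as a default. *)
  have [QM | QM] := boolP (Q \in M); last by exists 0.
  have [x xx QE] := rank_one_projectionP (projM _ QM).1 (rkM _ QM).
  by exists x => _; split=> // QE'; rewrite QE' eqxx in Qp.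
have [_ _ /(_ erefl) fp] := fP _ pM.
(* Listing [ketbra p] first makes the chosen basis start with [p]. *)
pose r := ketbra p :: rem (ketbra p) M.
have Mr : perm_eq M r by rewrite perm_to_rem.
have frE : map f r = p :: map f (rem (ketbra p) M) by rewrite /= fp.
have rM Q : Q \in r -> Q \in M by rewrite -(perm_mem Mr).
have fK : {in r, cancel f ketbra} by move=> Q /rM /fP[].
exists (map f (rem (ketbra p) M)); rewrite -[p :: _]frE; last first.
  apply/fsetP => Q; rewrite (perm_mem Mr); apply/idP/imfsetP => /=.
    by move=> Qr; exists (f Q); [exact: (map_f f Qr) | rewrite fK].
  by move=> [_ /(@mapP _ _ f r)[Q' Q'r ->] ->]; rewrite fK.
apply: orthonormal_basis_sum.
  apply/orthonormalP; split.
    rewrite map_inj_in_uniq -?(perm_uniq Mr) ?fset_uniq //.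
    exact: can_in_inj fK.
  move=> _ _ /mapP[Q Qr ->] /mapP[Q' Q'r ->].
  rewrite (inj_in_eq (can_in_inj fK)) //.
  have [-> | QQ'] := eqVneq Q Q'; first by have [] := fP _ (rM _ Q'r).
  have [x1 _ _] := fP _ (rM _ Q'r); have [y1 _ _] := fP _ (rM _ Qr).
  (* At [f Q], which [Q] fixes, the zero product reads [dot (f Q) (f Q') *: f Q' = 0], and [f Q'] is
     nonzero. *)
  have /lfunP/(_ (f Q)) : (Q' \o Q = 0)%VF.
    by apply: orthM; rewrite ?rM // eq_sym.
  rewrite -(fK _ Qr) -(fK _ Q'r) !(fK Q, fK Q') // comp_lfunE.
  rewrite -{1}(fK _ Qr) -(fK _ Q'r) !ketbraE y1 scale1r (fK _ Q'r) lfunE /=.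
  by move/eqP; rewrite scaler_eq0 (negbTE (unit_neq0 x1)) orbF => /eqP.
rewrite big_map -[RHS]sumM (perm_big _ Mr) /=.
by apply: eq_big_seq => Q /fK.
Qed.

End OrthonormalBases.

Theorem corollary3p3 (R : realType) (H : vectType R[i])
    (dot : {dot H for Num.conj}) (hd : (2 <= \dim {:H})%N)
    (P : 'End(H)) (hP : orthogonal_projection dot P) (hP1 : rank_one P) :
  let M1P := maximal_measurements dot `&` measurements_with dot P in
  group_action (range_fixing_unitaries dot P) (conj_measurement dot) M1P /\
  transitive_action (range_fixing_unitaries dot P) (conj_measurement dot) M1P.
Proof.
move=> M1P; have [p pp PE] := rank_one_projectionP hP hP1.
have fixE (U : unitary dot) : range_fixing_unitaries dot P U <-> U p = p.
  rewrite /range_fixing_unitaries /= PE limg_ketbra //; split=> [-> //|Up x].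
    exact: memv_line.
  by move=> /vlineP[a ->]; rewrite linearZ /= Up.
have M1PE M : M1P M <-> exists2 s,
    orthonormal_basis dot (p :: s) & M = basis_measurement dot (p :: s).
  split=> [[maxM [_ PM]]|[s ons ->]].
    by apply: maximal_measurement_basis; rewrite // -PE.
  have maxs := basis_measurement_maximal ons.
  split=> //; split; first exact: maxs.1.
  by rewrite PE; apply/imfsetP; exists p => //=; rewrite mem_head.
split; split.
- split=> [|U V|U]; rewrite ?fixE /=.
  + by rewrite id_lfunE.
  + by move=> Up Vp; rewrite comp_lfunE Vp.
  + move=> Up; have /andP[/eqP UU _] := valP U.
    (* The inverse is [adjoint dot U]; its argument [p] is rewritten as [U p] and the two operators
       cancel. *)
    by rewrite -{1}Up -comp_lfunE UU id_lfunE.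
- move=> U M /fixE Up /M1PE[s ons ->]; apply/M1PE.
  exists (map U s); last by rewrite conj_basis_measurement /= Up.
  by rewrite -{1}Up; exact: (unitary_orthonormal_basis U ons).
- move=> M /M1PE[s _ ->]; rewrite conj_basis_measurement.
  by congr basis_measurement; apply: map_id_in => x _; exact: id_lfunE.
- move=> U V M _ _ /M1PE[s _ ->]; rewrite !conj_basis_measurement -map_comp.
  by congr basis_measurement; apply: eq_map => x; exact: comp_lfunE.
(* An orbit must be nonempty: extending the unit vector [p] to an orthonormal basis provides a
   member. *)
- have [||t ont] := @orthonormal_extend _ _ dot [:: p].
  + by rewrite /orthonormal /= pp eqxx.
  + exact: ltnW hd.
  by exists (basis_measurement dot (p :: t)); apply/M1PE; exists t.
- move=> M N /M1PE[s ons ->] /M1PE[t ont ->].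
  have [U Ust] := unitary_of_orthonormal_bases ons ont.
  (* Comparing the heads of [map U (p :: s)] and [p :: t] gives [U p = p], which puts [U] in the
     group. *)
  have [Up _] := Ust.
  by exists U; [exact/fixE | rewrite conj_basis_measurement Ust].
Qed.
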